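(* Let $H$ be a real Hilbert space with identity mapping $I:H\to H$. Let $f:H\to H$ be a contraction with constant $\alpha$, $0<\alpha<1$ (i.e. $\|f(x)-f(y)\|\le\alpha\|x-y\|$ for all $x,y\in H$), let $A:H\to H$ be a $k$-Lipschitzian and $\eta$-strongly monotone mapping ($k>0$, $\eta>0$), let $N\ge 1$, and let $T_1,\dots,T_N:H\to H$ be nonexpansive mappings with $F:=\bigcap_{i=1}^N F(T_i)\neq\emptyset$. Suppose that $0<\mu<\frac{2\eta}{k^2}$, put $\tau:=\mu\left(\eta-\frac{\mu k^2}{2}\right)$, suppose that $0<\gamma<\frac{\tau}{\alpha}$, and suppose that the sequence $\{\alpha_n\}_{n=1}^\infty\subset(0,1)$ satisfies (i) $\lim_{n\to\infty}\alpha_n=0$; (ii) $\sum_{n=1}^\infty\alpha_n=\infty$; (iii) $\lim_{n\to\infty}\frac{\alpha_n}{\alpha_{n+N}}=1$. Suppose further that $$F=F(T_NT_{N-1}\cdots T_1)=F(T_1T_NT_{N-1}\cdots T_2)=F(T_2T_1T_NT_{N-1}\cdots T_3)=\cdots=F(T_{N-1}T_{N-2}\cdots T_1T_N).$$ Let $x_1\in H$ be arbitrary and define $\{x_n\}_{n=1}^\infty$ by $$x_{n+1}=\alpha_n\gamma f(x_n)+(I-\alpha_n\mu A)T_nx_n,\qquad n\in\mathbb{N},$$ where $T_n:=T_{n \,(\mathrm{mod}\, N)}$. Then $\{x_n\}_{n=1}^\infty$ converges strongly (in norm) to the unique solution $x'\in F$ of the variational inequality $$\left\langle(\gamma f-\mu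 A)x',\,y-x'\right\rangle\le 0\qquad\text{for all } y\in F.$$
   Context: For a mapping $T:H\to H$, $F(T)=\{x\in H: Tx=x\}$ denotes its set of fixed points. $T$ is nonexpansive if $\|Tx-Ty\|\le\|x-y\|$ for all $x,y\in H$. A mapping $A:H\to H$ (not necessarily linear) is $k$-Lipschitzian if $\|Ax-Ay\|\le k\|x-y\|$ for all $x,y\in H$, and $\eta$-strongly monotone if $\langle x-y,Ax-Ay\rangle\ge\eta\|x-y\|^2$ for all $x,y\in H$. Products of mappings denote composition, so $(I-\alpha_n\mu A)T_nx_n=T_nx_n-\alpha_n\mu A(T_nx_n)$. The index $n\,(\mathrm{mod}\,N)$ takes values in $\{1,\dots,N\}$, i.e. the sequence $T_1,T_2,T_3,\dots$ is the $N$-periodic extension of $T_1,\dots,T_N$. The equalities in the hypothesis on $F$ say that for every one of the $N$ cyclic rotations of the composition $T_NT_{N-1}\cdots T_1$, the fixed point set of the composition equals $F$. *)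

(* Defs.v *)
From HB Require Import structures.
From mathcomp Require Import all_boot all_order all_algebra sesquilinear.
From mathcomp Require Import all_classical all_reals all_analysis.

Set Implicit Arguments.
Unset Strict Implicit.
Unset Printing Implicit Defensive.

Import Order.TTheory GRing.Theory Num.Theory.
Import numFieldNormedType.Exports.

Local Open Scope classical_set_scope.
Local Open Scope ring_scope.

(* A real Hilbert space is given by a complete normed module H over R, a
   symmetric positive definite bilinear form dot on H, and the requirement that
   the norm of H (hence its topology) is the one induced by dot. *)
Definition norm_induced_by (R : realType) (H : completeNormedModType R)
    (dot : {dot H for (@idfun R)}) : Prop :=
  forall x : H, `|x| ^+ 2 = dot x x.

Definition strongly_monotone (R : realType) (H : completeNormedModType R)
    (dot : {dot H for (@idfun R)}) (eta : R) (A : H -> H) : Prop :=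
  forall x y : H, eta * `|x - y| ^+ 2 <= dot (x - y) (A x - A y).

Definition fixpts (X : Type) (T : X -> X) : set X := [set x | T x = x].

Definition common_fixpts (X : Type) (N : nat) (T : nat -> X -> X) : set X :=
  \bigcap_(i in [set i | (1 <= i <= N)%N]) fixpts (T i).

(* The N-periodic extension of T 1, ..., T N, numbered from 1: for n >= 1 the
   index (n.-1 %% N).+1 is the representative of n modulo N in {1, ..., N}. *)
Definition periodic_ext (X : Type) (N : nat) (T : nat -> X -> X) (n : nat) : X -> X :=
  T (n.-1 %% N).+1.

(* iter_comp S r m = S (r + m) \o ... \o S (r + 2) \o S (r + 1); the rightmost
   factor is applied first. *)
Fixpoint iter_comp (X : Type) (S : nat -> X -> X) (r m : nat) : X -> X :=
  if m is m'.+1 then S (r + m)%N \o iter_comp S r m' else id.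

Definition VI_solution (R : realType) (H : completeNormedModType R)
    (dot : {dot H for (@idfun R)}) (F : set H) (B : H -> H) (x : H) : Prop :=
  F x /\ forall y, F y -> dot (B x) (y - x) <= 0.

(* Main.v *)
Require Import Defs.
From HB Require Import structures.
From mathcomp Require Import all_boot all_order all_algebra sesquilinear.
From mathcomp Require Import all_classical all_reals all_analysis.
From mathcomp Require Import ring lra.
Import Order.TTheory GRing.Theory Num.Theory.
Import numFieldNormedType.Exports.
Local Open Scope classical_set_scope.
Local Open Scope ring_scope.

Set Implicit Arguments.
Unset Strict Implicit.
Unset Printing Implicit Defensive.

(** Write c = tau - gamma alpha > 0, S_n for the periodic extension of the T_i,
    and Phi_n z = a_n gamma f z + (I - a_n mu A) S_n z, so that
    x_(n+1) = Phi_n x_n. Strong monotonicity and the Lipschitz bound on A make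
    I - s mu A a (1 - s tau)-Lipschitz map for 0 <= s <= 1
    ([descent_lipschitz]), hence Phi_n is (1 - a_n c)-Lipschitz
    ([hybrid_step_lipschitz]). For p in F, Phi_n moves p only by a_n B p, where
    B = gamma f - mu A.

    Existence and uniqueness of x': the map I + B is a strict contraction (this
    is the same Lipschitz estimate with s = 1), F is closed and convex, and the
    variational inequality says that x' is the fixed point of the projection
    onto F composed with I + B ([contraction_VI]).

    Convergence: all estimates end in one recursive inequality,
    s_(n+1) <= (1 - l_n) s_n + l_n e_n with l_n = a_n c, whose solutions tend to
    0 when the l_n have divergent sum and limsup e_n <= 0 ([rec_le_cvg0]).
    Applied to |x_n - x_(n-N)| it gives |x_(n+N) - x_n| -> 0, because
    S_n = S_(n-N) and the two steps differ only through |a_n - a_(n-N)|, which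
    is o(a_n) by the ratio hypothesis. As x_(n+1) - S_n x_n -> 0 too, x_(n+1)
    is asymptotically fixed by the composition of the next N maps
    ([asymptotic_regularity]); this composition depends only on n modulo N, and
    its fixed point set is F. By demiclosedness every weak cluster point of the
    sequence lies in F, so limsup <B x', x_(n+1) - x'> <= 0
    ([limsup_drift_le0]). Expanding |x_(n+1) - x'|^2 around the contracted part
    of the step yields the same recursive inequality for |x_n - x'|^2
    ([hybrid_iteration_cvg]).

    Weak compactness is obtained along an ultrafilter U: a bounded real family
    converges along U, so y |-> lim_U <z_t, y> is a bounded linear functional
    whenever z is bounded, and its Riesz representative is a weak limit
    ([bounded_ultra_weak_cvg]). The Riesz theorem and the projection onto closed
    convex sets both come from a single existence result for minimizers
    ([exists_minimizer]). *)

(** * Lipschitz maps and recursive inequalities *)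

Lemma lipschitzP (R : realType) (V W : normedModType R) (q : R) (g : V -> W) :
  q.-lipschitz g <-> forall u v, `|g u - g v| <= q * `|u - v|.
Proof.
split=> [gq u v|gq [u v] _]; last exact: gq.
exact: (gq (u, v)).
Qed.

Lemma lipschitz_continuous (R : realType) (V W : normedModType R) (q : R)
  (g : V -> W) : q.-lipschitz g -> continuous g.
Proof.
move=> /lipschitzP gq u; apply/cvgrPdist_le => e e0.
have q0 : 0 < `|q| + 1 by rewrite ltr_wpDl.
near=> v; apply: (le_trans (gq u v)).
apply: (@le_trans _ _ ((`|q| + 1) * `|u - v|)).
  by rewrite ler_wpM2r// (le_trans (ler_norm q))// lerDl.
rewrite -ler_pdivlMl//; near: v; apply: cvgr_dist_le => //.
by rewrite mulr_gt0// invr_gt0.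
Unshelve. all: by end_near. Qed.

Section recursive_inequality.
Variables (R : realType) (s lam : nat -> R).
Hypothesis lam01 : \forall n \near \oo, 0 <= lam n <= 1.

(** Each term is at most a convex combination of its predecessor and [M]. *)
Lemma rec_le_bounded (M : R) :
  (\forall n \near \oo, s n.+1 <= (1 - lam n) * s n + lam n * M) ->
  exists K, \forall n \near \oo, s n <= K.
Proof.
move=> sM; have [n0 _ n0P] := filterI lam01 sM.
exists (Num.max (s n0) M); exists n0 => // n /= n0n.
rewrite -(subnKC n0n); elim: (n - n0)%N => [|j ih].
  by rewrite addn0 le_max lexx.
rewrite addnS.
have [/andP[l0 l1] /le_trans-> //] := n0P (n0 + j)%N (leq_addr _ _).
set K := Num.max _ _ in ih *.
have MK : M <= K by rewrite le_max lexx orbT.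
have := ler_wpM2l l0 MK.
have : (1 - lam (n0 + j)%N) * s (n0 + j)%N <= (1 - lam (n0 + j)%N) * K.
  by rewrite ler_wpM2l// subr_ge0.
by lra.
Qed.

(** Subtracting half the target error leaves d_(n+1) <= (1 - l_n) d_n for the
    positive part d. The product of the (1 - l_i) is at most the inverse of
    1 + the sum of the l_i, since (1 - l)(1 + L + l) <= 1 + L, and this sum
    diverges. *)
Lemma rec_le_cvg0 :
  (forall n, 0 <= s n) ->
  \sum_(1 <= n < m) lam n @[m --> \oo] --> +oo ->
  (forall e, 0 < e ->
    \forall n \near \oo, s n.+1 <= (1 - lam n) * s n + lam n * e) ->
  s n @[n --> \oo] --> (0 : R).
Proof.
move=> s0 lamoo srec; apply/cvgrPdist_le => e e0.
have e20 : 0 < e / 2 by rewrite divr_gt0.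
have [n0 _ n0P] := filterI lam01 (filterI (srec _ e20) (nbhs_infty_gt 0%N)).
pose d n := Num.max (s n - e / 2) 0.
have d0 n : 0 <= d n by rewrite le_max lexx orbT.
pose L j := \sum_(n0 <= i < n0 + j) lam i.
have L0 j : 0 <= L j.
  rewrite /L big_nat_cond; apply: sumr_ge0 => i /andP[/andP[n0i _] _].
  by have [/andP[]] := n0P i n0i.
have dL j : d (n0 + j)%N * (1 + L j) <= d n0.
  elim: j => [|j ih]; first by rewrite /L addn0 big_geq// addr0 mulr1.
  have [/andP[l0 l1] [sj _]] := n0P (n0 + j)%N (leq_addr _ _).
  apply: le_trans ih; rewrite addnS.
  have -> : L j.+1 = L j + lam (n0 + j)%N.
    by rewrite /L addnS big_nat_recr//= leq_addr.
  set l := lam _ in l0 l1 sj *.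
  have ds : d (n0 + j).+1 <= (1 - l) * d (n0 + j)%N.
    have l10 : 0 <= 1 - l by rewrite subr_ge0.
    have sd : s (n0 + j)%N - e / 2 <= d (n0 + j)%N by rewrite le_max lexx.
    rewrite ge_max mulr_ge0// andbT.
    by have := ler_wpM2l l10 sd; lra.
  have L1 : 0 <= 1 + (L j + l) by rewrite !addr_ge0.
  apply: (le_trans (ler_wpM2r L1 ds)).
  rewrite [(1 - l) * _]mulrC -mulrA ler_wpM2l//.
  by have := mulr_ge0 l0 (L0 j); have := sqr_ge0 l; rewrite expr2; lra.
near=> n; rewrite sub0r normrN ger0_norm//.
have n0n : (n0 <= n)%N by near: n; exact: nbhs_infty_ge.
have := dL (n - n0)%N; rewrite subnKC// => dn.
have Ln : d n0 / (e / 2) <= L (n - n0)%N.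
  have -> : L (n - n0)%N = \sum_(1 <= i < n) lam i - \sum_(1 <= i < n0) lam i.
    have [_ [_ n00]] := n0P n0 (leqnn _).
    by rewrite (big_cat_nat n00 n0n)/= /L subnKC//; ring.
  rewrite lerBrDr; near: n.
  by move/cvgryPge : lamoo; apply.
have sn : s n <= e / 2 + d n.
  by rewrite addrC -lerBlDr le_max lexx.
suff : d n <= e / 2 by lra.
rewrite leNgt; apply/negP => edn.
have : d n0 <= e / 2 * L (n - n0)%N by rewrite mulrC -ler_pdivrMr.
have := L0 (n - n0)%N; set l := L _ in dn Ln *; move=> l0.
have := mulr_ge0 (ltW (le_lt_trans (ltW e20) edn)) l0.
have : 0 <= (d n - e / 2) * l by rewrite mulr_ge0// subr_ge0 ltW.
by lra.
Unshelve. all: by end_near. Qed.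

End recursive_inequality.

(** * The inner product *)

Section hilbert_space.
Variables (R : realType) (H : completeNormedModType R).
Variable dot : {dot H for (@idfun R)}.
Hypothesis Hdot : norm_induced_by dot.
Implicit Types (u v w x y z : H) (s : R).

Lemma dotDl u v w : dot (u + v) w = dot u w + dot v w.
Proof. exact: linearDl. Qed.
Lemma dotDr u v w : dot u (v + w) = dot u v + dot u w.
Proof. exact: linearDr. Qed.
Lemma dotNl u w : dot (- u) w = - dot u w.
Proof. exact: linearNl. Qed.
Lemma dotNr u w : dot u (- w) = - dot u w.
Proof. exact: linearNr. Qed.
Lemma dotZl s u w : dot (s *: u) w = s * dot u w.
Proof. exact: linearZl_LR. Qed.
Lemma dotZr s u w : dot u (s *: w) = s * dot u w.
Proof. exact: linearZr_LR. Qed.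
Lemma dotC u v : dot u v = dot v u.
Proof. by rewrite hermC/= expr0 mul1r. Qed.

Definition dotE := (dotDl, dotDr, dotNl, dotNr, dotZl, dotZr).

Lemma normsqD u v : `|u + v| ^+ 2 = `|u| ^+ 2 + 2 * dot u v + `|v| ^+ 2.
Proof. by rewrite !Hdot !dotE (dotC v u); ring. Qed.

(** Cauchy-Schwarz is read off the triangle inequality of the norm. *)
Lemma dot_le_norm u v : dot u v <= `|u| * `|v|.
Proof.
have := ler_normD u v.
rewrite -(@ler_sqr R) ?nnegrE ?addr_ge0// normsqD.
by rewrite sqrrD -mulr_natl; lra.
Qed.

Lemma norm_dot_le u v : `|dot u v| <= `|u| * `|v|.
Proof.
rewrite ler_norml dot_le_norm andbT lerNl -dotNl (le_trans (dot_le_norm _ _))//.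
by rewrite normrN.
Qed.

(** The uniform convexity of the squared norm: the source of uniqueness and of
    convergence in all the minimization arguments below. *)
Lemma normsq_segment u x y s :
  `|u - (x + s *: (y - x))| ^+ 2 =
  (1 - s) * `|u - x| ^+ 2 + s * `|u - y| ^+ 2 - s * (1 - s) * `|x - y| ^+ 2.
Proof.
by rewrite !Hdot !dotE (dotC x u) (dotC y u) (dotC y x); ring.
Qed.

Lemma le0_of_le_small (a b : R) :
  (forall s, 0 < s <= 1 -> 2 * a <= s * b) -> a <= 0.
Proof.
move=> ab; rewrite leNgt; apply/negP => a0.
have b0 : 0 < `|b| + 1 by rewrite ltr_wpDl.
pose s := Num.min 1 (a / (`|b| + 1)).
have s0 : 0 < s by rewrite lt_min ltr01 divr_gt0.
have := ab s; rewrite s0 ge_min lexx => /(_ isT).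
have : s * (`|b| + 1) <= a by rewrite -ler_pdivlMr// ge_min lexx orbT.
by have := ler_wpM2l (ltW s0) (ler_norm b); lra.
Qed.

(** First-order optimality condition of the squared norm in direction [- v]. *)
Lemma dot_le0_of_min u v :
  (forall s, 0 < s <= 1 -> `|u| ^+ 2 <= `|u - s *: v| ^+ 2) -> dot u v <= 0.
Proof.
move=> umin; apply: (@le0_of_le_small _ (`|v| ^+ 2)) => s s01.
have /andP[s0 _] := s01; have := umin s s01.
rewrite normsqD normrN normrZ exprMn real_normK ?num_real// dotNr dotZr => h.
by rewrite -(ler_pM2l s0); lra.
Qed.

(** * Minimizers, Riesz representation and variational inequalities *)

(** Midpoint convexity with the quadratic gain |x - y|^2 / 4 bounds the distance
    of two almost minimizing points by the excess of their values, so every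
    minimizing sequence is Cauchy. *)
Lemma exists_minimizer (C : set H) (g : H -> R) (m : R) :
  C !=set0 -> closed C -> continuous g ->
  (forall x y, C x -> C y -> C (x + 2^-1 *: (y - x)) /\
    g (x + 2^-1 *: (y - x)) <= (g x + g y) / 2 - `|x - y| ^+ 2 / 4) ->
  (forall y, m <= g y) ->
  exists2 c, C c & forall y, C y -> g c <= g y.
Proof.
move=> [c0 Cc0] Ccl gcont gconv gm.
have gC0 : (g @` C) !=set0 by exists (g c0); exists c0.
have gClb : has_lbound (g @` C) by exists m => _ [y _ <-].
have gCinf : has_inf (g @` C) by split.
pose i := inf (g @` C).
have ig y : C y -> i <= g y by move=> Cy; apply: ge_inf => //; exists y.
have : forall n : nat, exists y, C y /\ g y < i + n.+1%:R^-1.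
  move=> n; have n0 : 0 < n.+1%:R^-1 :> R by rewrite invr_gt0.
  by have [_ [y Cy <-]] := inf_adherent n0 gCinf; exists y.
move=> /choice[y yP].
have ydist n k : `|y n - y k| ^+ 2 <= 2 * (n.+1%:R^-1 + k.+1%:R^-1).
  have [[Cn gn] [Ck gk]] := (yP n, yP k).
  move: gn gk; move: (n.+1%:R^-1) (k.+1%:R^-1) => a b gn gk.
  by have [/ig ? ?] := gconv _ _ Cn Ck; lra.
have ycvg : cvg (y @ \oo).
  apply/cauchy_cvgP/cauchy_exP => e e0.
  have e40 : 0 < e ^+ 2 / 4 by rewrite divr_gt0// exprn_gt0.
  have [n0 _ /(_ _ (leqnn _))/= n0e] := near_infty_natSinv_lt (PosNum e40).
  exists (y n0), n0 => // k /= n0k; rewrite -ball_normE/=.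
  rewrite -(@ltr_sqr R) ?nnegrE// ?(ltW e0)// (le_lt_trans (ydist n0 k))//.
  have : k.+1%:R^-1 <= n0.+1%:R^-1 :> R by rewrite lef_pV2 ?posrE// ler_nat.
  by move: n0e; move: (k.+1%:R^-1) (n0.+1%:R^-1) => a b; lra.
have Cc : C (lim (y @ \oo)).
  by apply: (closed_cvg C) ycvg => //; apply: nearW => n; have [] := yP n.
exists (lim (y @ \oo)) => // z Cz; apply: le_trans (ig _ Cz).
have gy : g (y n) @[n --> \oo] --> g (lim (y @ \oo)).
  by apply: continuous_cvg ycvg; exact: gcont.
have iy : i + n.+1%:R^-1 @[n --> \oo] --> i.
  rewrite -[X in _ --> X]addr0; apply: cvgD; first exact: cvg_cst.
  exact: cvg_harmonic.
apply: ler_cvg_to gy iy _; apply: nearW => n.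
by have [_ /ltW] := yP n.
Unshelve. all: by end_near. Qed.

(** The representative is the minimizer of |y|^2 - 2 L y: its Euler equation is
    L y = <c, y>. *)
Lemma riesz_representation (L : H -> R) (K : R) :
  (forall x y, L (x + y) = L x + L y) -> (forall s x, L (s *: x) = s * L x) ->
  (forall x, `|L x| <= K * `|x|) ->
  exists c, forall y, L y = dot c y.
Proof.
move=> LD LZ LK.
have LN x : L (- x) = - L x by rewrite -scaleN1r LZ mulN1r.
have LB x y : L (x - y) = L x - L y by rewrite LD LN.
have Lcont : continuous (L : H -> R).
  by apply: (@lipschitz_continuous _ _ _ K); apply/lipschitzP => x y; rewrite -LB.
pose g y := `|y| ^+ 2 - 2 * L y.
have gcont : continuous g.
  move=> y; apply: cvgB.
    by apply: cvgM; apply: cvg_norm; exact: cvg_id.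
  by apply: cvgM; [exact: cvg_cst|exact: Lcont].
have [|||||c _ cmin] := @exists_minimizer setT g (- K ^+ 2).
- by exists 0.
- exact: closedT.
- exact: gcont.
- move=> x y _ _; split => //; rewrite /g LD LZ LB.
  have := normsq_segment 0 x y 2^-1.
  by rewrite !sub0r !normrN => ->; lra.
- move=> y; rewrite /g; have := LK y.
  have := sqr_ge0 (`|y| - K); have := ler_norm (L y); rewrite sqrrB -mulr_natl.
  by lra.
have Lle y : dot c y - L y <= 0.
  apply: (@le0_of_le_small _ (`|y| ^+ 2)).
  move=> s /andP[s0 s1]; have := cmin (c - s *: y) I.
  rewrite /g LB LZ normsqD normrN normrZ exprMn real_normK ?num_real// dotNr dotZr.
  move=> h; by rewrite -(ler_pM2l s0); lra.
exists c => y; apply/eqP; rewrite eq_le.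
have := Lle y; have := Lle (- y); rewrite dotNr LN.
by move=> ? ?; apply/andP; split; lra.
Qed.


Definition segment_closed (C : set H) :=
  forall x y s, C x -> C y -> 0 <= s <= 1 -> C (x + s *: (y - x)).

(** The projection of u minimizes |u - y|; the obtuse angle condition is its
    first-order optimality condition. *)
Lemma exists_projection (C : set H) u :
  C !=set0 -> closed C -> segment_closed C ->
  exists c, C c /\ forall y, C y -> dot (u - c) (y - c) <= 0.
Proof.
move=> C0 Ccl Cseg.
have half01 : 0 <= (2^-1 : R) <= 1 by apply/andP; split; lra.
have [|||c Cc cmin] := @exists_minimizer C (fun y => `|u - y| ^+ 2) 0 C0 Ccl.
- have cont : continuous (fun y => `|u - y|).
    by move=> y; apply: cvg_norm; apply: cvgB; [exact: cvg_cst|exact: cvg_id].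
  by move=> y; apply: cvgM; exact: cont.
- move=> x y Cx Cy; split; first exact: Cseg.
  by rewrite normsq_segment; lra.
- by move=> y; exact: sqr_ge0.
exists c; split => // y Cy; apply: dot_le0_of_min => s /andP[s0 s1].
have /cmin : C (c + s *: (y - c)) by apply: Cseg => //; rewrite (ltW s0).
by rewrite opprD addrA.
Qed.

(** Solutions are the fixed points of P \o Phi, with P the projection onto C,
    and P is nonexpansive by the obtuse angle condition at two points. *)
Lemma contraction_VI (C : set H) (Phi : H -> H) (q : R) :
  C !=set0 -> closed C -> segment_closed C -> q < 1 -> q.-lipschitz Phi ->
  exists x, unique (VI_solution dot C (fun z => Phi z - z)) x.
Proof.
move=> C0 Ccl Cseg q1 /lipschitzP Phiq.
have /choice[P PP] := fun u => exists_projection u C0 Ccl Cseg.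
have P1 u v : `|P u - P v| <= `|u - v|.
  have [[CPu Pu] [CPv Pv]] := (PP u, PP v).
  have : `|P u - P v| ^+ 2 <= dot (u - v) (P u - P v).
    have := Pu _ CPv; have := Pv _ CPu.
    by rewrite Hdot !dotE (dotC (P v) (P u)); lra.
  move/le_trans/(_ (dot_le_norm _ _)).
  have [->//|] := eqVneq (P u - P v) 0; first by rewrite normr0.
  by rewrite -normr_gt0 expr2 => p0; rewrite ler_pM2r.
have q'0 : 0 <= Num.max q 0 by rewrite le_max lexx orbT.
pose F : {fun [set: H] >-> [set: H]} := [fun of totalfun (P \o Phi)].
have Fctr : is_contraction F.
  exists (NngNum q'0); split => /=; first by rewrite gt_max q1 ltr01.
  apply/lipschitzP => u v; apply: (le_trans (P1 _ _)).
  by apply: (le_trans (Phiq u v)); rewrite ler_wpM2r// le_max lexx.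
have [|x _ xF] := banach_fixed_point Fctr closedT; first by exists 0.
have {xF}xP : x = P (Phi x) := xF.
have [Cx xVI] : C x /\ forall y, C y -> dot (Phi x - x) (y - x) <= 0.
  by rewrite {1 3 4}xP; exact: PP.
exists x; split => // y [Cy yVI].
apply/eqP; rewrite -subr_eq0 -normr_le0.
have := xVI _ Cy; have := yVI _ Cx.
have : dot (Phi x - Phi y) (x - y) <= q * `|x - y| ^+ 2.
  rewrite expr2 mulrA; apply: (le_trans (dot_le_norm _ _)).
  by rewrite ler_wpM2r.
rewrite Hdot !dotE (dotC y x) => h1 h2 h3.
have h : (1 - q) * `|x - y| ^+ 2 <= 0.
  by rewrite Hdot !dotE (dotC y x); lra.
rewrite leNgt; apply/negP => xy0.
have : 0 < (1 - q) * `|x - y| ^+ 2 by rewrite mulr_gt0 ?subr_gt0// exprn_gt0.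
by lra.
Qed.

(** * Fixed points of nonexpansive maps and weak limits *)

Lemma fixpts_closed (W : H -> H) : 1.-lipschitz W -> closed (fixpts W).
Proof.
move=> /lipschitz_continuous Wc.
have -> : fixpts W = (fun x => W x - x) @^-1` [set 0].
  by apply/seteqP; split => x /= /eqP; [rewrite -subr_eq0|rewrite subr_eq0] => /eqP.
apply: preimage_closed; last first.
  exact: (accessible_closed_set1 (hausdorff_accessible (@norm_hausdorff _ H))).
by move=> x _; apply: cvgB; [exact: Wc|exact: cvg_id].
Qed.

(** If z lies on the segment [x, y], then W z is at most as far from x and from
    y as z is; by uniform convexity z is the only such point. *)
Lemma fixpts_segment (W : H -> H) : 1.-lipschitz W -> segment_closed (fixpts W).
Proof.
move=> /lipschitzP W1 x y s Wx Wy /andP[s0 s1].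
rewrite /fixpts/=; set z := x + _.
apply/eqP; rewrite -subr_eq0 -normr_le0.
have zx : `|W z - x| <= s * `|x - y|.
  rewrite -{1}Wx (le_trans (W1 z x))// mul1r /z addrC addKr normrZ ger0_norm//.
  by rewrite distrC.
have zy : `|W z - y| <= (1 - s) * `|x - y|.
  rewrite -{1}Wy (le_trans (W1 z y))// mul1r.
  have -> : z - y = (1 - s) *: (x - y).
    by rewrite /z scalerBl scale1r -(opprB y x) scalerN opprB opprK addrAC.
  by rewrite normrZ ger0_norm// subr_ge0.
have sqr_le (a b : R) : 0 <= a -> a <= b -> a ^+ 2 <= b ^+ 2.
  by move=> a0 ab; rewrite ler_sqr ?nnegrE// (le_trans a0).
have {}zx := sqr_le _ _ (normr_ge0 _) zx.
have {}zy := sqr_le _ _ (normr_ge0 _) zy.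
have s10 : 0 <= 1 - s by rewrite subr_ge0.
have {}zx := ler_wpM2l s10 zx; have {}zy := ler_wpM2l s0 zy.
suff : `|W z - z| ^+ 2 <= 0 by rewrite exprn_even_le0//= => /eqP->.
by rewrite normsq_segment; lra.
Qed.

Lemma common_fixpts_closed (N : nat) (T : nat -> H -> H) :
  (forall i, (1 <= i <= N)%N -> 1.-lipschitz (T i)) ->
  closed (common_fixpts N T).
Proof. by move=> T1; apply: closed_bigI => i /T1; exact: fixpts_closed. Qed.

Lemma common_fixpts_segment (N : nat) (T : nat -> H -> H) :
  (forall i, (1 <= i <= N)%N -> 1.-lipschitz (T i)) ->
  segment_closed (common_fixpts N T).
Proof.
by move=> T1 x y s Fx Fy s01 i iN; apply: fixpts_segment;
  [exact: T1|exact: Fx|exact: Fy|].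
Qed.

(** A cluster point in the compact interval [- K, K] is a limit, as an
    ultrafilter decides every neighbourhood of it. *)
Lemma ultra_bounded_cvg (I : Type) (U : set_system I) (h : I -> R) (K : R) :
  UltraFilter U -> (\forall t \near U, `|h t| <= K) -> cvg (h @ U).
Proof.
move=> UU hK.
have hUK : (h @ U) [set` `[- K, K]].
  by apply: filterS hK => t; rewrite /= in_itv/= -ler_norml.
have [p [_ clp]] := @segment_compact R (- K) K (h @ U) _ hUK.
apply/cvg_ex; exists p => V Vp; rewrite nbhs_simpl/=.
have [//|UV] := in_ultra_setVsetC (h @^-1` V) UU.
by have [y []] := clp (~` V) V UV Vp.
Qed.

(** The limit functional y |-> lim_U <z t, y> is linear and bounded by K, and
    Riesz representation turns it into a point. *)
Lemma bounded_ultra_weak_cvg (I : Type) (U : set_system I) (z : I -> H) (K : R) :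
  UltraFilter U -> (\forall t \near U, `|z t| <= K) ->
  exists c, forall y, dot (z t) y @[t --> U] --> dot c y.
Proof.
move=> UU zK.
have zyK y : \forall t \near U, `|dot (z t) y| <= K * `|y|.
  apply: filterS zK => t ztK; apply: (le_trans (norm_dot_le _ _)).
  by rewrite ler_wpM2r.
pose L y : R := lim (dot (z t) y @[t --> U]).
have LP y : dot (z t) y @[t --> U] --> L y.
  exact: (@ultra_bounded_cvg I U (fun t => dot (z t) y) _ UU (zyK y)).
have [|||c cP] := @riesz_representation L K.
- move=> x y; apply/cvg_lim => //.
  under eq_fun do rewrite dotDr; apply: cvgD; exact: LP.
- move=> s x; apply/cvg_lim => //.
  under eq_fun do rewrite dotZr; apply: cvgM; [exact: cvg_cst|exact: LP].
- move=> x; rewrite ler_norml; apply/andP; split.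
    apply: limr_ge; first by apply/cvg_ex; exists (L x); exact: LP.
    by apply: filterS (zyK x) => t; rewrite ler_norml => /andP[].
  apply: limr_le; first by apply/cvg_ex; exists (L x); exact: LP.
  by apply: filterS (zyK x) => t; rewrite ler_norml => /andP[].
by exists c => y; rewrite -cP; exact: LP.
Qed.

(** The expansion of |z - W c|^2 around c and the bound
    |z - W c| <= |z - W z| + |z - c| give
    2 <z - c, c - W c> + |c - W c|^2 <= e (e + 2 |z - c|) with e = |z - W z|;
    passing to the limit leaves |c - W c|^2 <= 0. *)
Lemma demiclosed (I : Type) (U : set_system I) (W : H -> H) (z : I -> H) (K : R)
  (c : H) : ProperFilter U -> 1.-lipschitz W ->
  (\forall t \near U, `|z t| <= K) ->
  (forall y, dot (z t) y @[t --> U] --> dot c y) ->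
  `|z t - W (z t)| @[t --> U] --> (0 : R) -> W c = c.
Proof.
move=> UU /lipschitzP W1 zK zc zW.
suff : `|c - W c| ^+ 2 <= 0.
  by rewrite exprn_even_le0//= normr_eq0 subr_eq0 => /eqP <-.
pose e t := `|z t - W (z t)|.
have lhs : 2 * dot (z t - c) (c - W c) + `|c - W c| ^+ 2 @[t --> U] -->
    `|c - W c| ^+ 2.
  rewrite -[X in _ --> X]add0r; apply: cvgD; last exact: cvg_cst.
  rewrite -(mulr0 2); apply: cvgM; first exact: cvg_cst.
  under eq_fun do rewrite dotDl dotNl.
  rewrite -(subrr (dot c (c - W c))).
  by apply: cvgB; [exact: zc|exact: cvg_cst].
have rhs : e t * (e t + 2 * (K + `|c|)) @[t --> U] --> (0 : R).
  rewrite -(mul0r (0 + 2 * (K + `|c|))).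
  by apply: cvgM; [exact: zW|apply: cvgD; [exact: zW|exact: cvg_cst]].
rewrite -subr_ge0; apply: cvgr_to_ge (cvgB rhs lhs) _.
apply: filterS zK => t ztK; rewrite fctE subr_ge0.
have zWc : `|z t - W c| <= e t + `|z t - c|.
  rewrite (le_trans (ler_distD (W (z t)) _ _))// lerD2l.
  by rewrite (le_trans (W1 _ _))// mul1r.
have zcK : `|z t - c| <= K + `|c|.
  by rewrite (le_trans (ler_normB _ _))// lerD2r.
have e0 : 0 <= e t by exact: normr_ge0.
have := normsqD (z t - c) (c - W c); rewrite addrA subrK.
have : `|z t - W c| ^+ 2 <= (e t + `|z t - c|) ^+ 2.
  by rewrite ler_sqr ?nnegrE// addr_ge0.
have := ler_wpM2l e0 zcK.
by lra.
Qed.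

(** Otherwise some ultrafilter finer than G stays in the set where the product
    exceeds e, and the weak limit along it is a fixed point of W violating the
    inequality at p. *)
Lemma limsup_dot_le0 (I : Type) (G : set_system I) (W : H -> H) (z : I -> H)
  (K : R) (b p : H) : Filter G -> 1.-lipschitz W ->
  (\forall t \near G, `|z t| <= K) ->
  `|z t - W (z t)| @[t --> G] --> (0 : R) ->
  (forall y, W y = y -> dot b (y - p) <= 0) ->
  forall e, 0 < e -> \forall t \near G, dot b (z t - p) <= e.
Proof.
move=> GG W1 zK zW bp e e0; apply: contrapT => nG.
pose D := [set t | ~ dot b (z t - p) <= e].
have GD : ProperFilter (within D G).
  split; last exact: within_filter.
  move=> G0; apply: nG; move: G0; rewrite /within/=; apply: filterS => t Dt.
  by apply: contrapT => /Dt.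
have [U [UU GU]] := ultraFilterLemma GD.
have GU' : G `<=` U by move=> X GX; apply: GU; exact: (@cvg_within _ G _ D).
have [c zc] := @bounded_ultra_weak_cvg I U z K UU (GU' _ zK).
have Wc : W c = c.
  apply: demiclosed W1 (GU' _ zK) zc _.
  by move=> V /zW; exact: GU'.
have zp : dot b (z t - p) @[t --> U] --> dot b (c - p).
  under eq_fun do rewrite dotDr (dotC b (z _)).
  by rewrite dotDr (dotC b c); apply: cvgD; [exact: zc|exact: cvg_cst].
have : e <= dot b (c - p).
  rewrite -(cvg_lim _ zp)//; apply: limr_ge; first by apply/cvg_ex; exists (dot b (c - p)).
  have : U D by apply: GU; exact: withinT.
  by apply: filterS => t /negP; rewrite -ltNge => /ltW.
by have := bp c Wc; lra.
Qed.

(** * The hybrid steepest descent step *)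

(** The case q < 0 is meaningful: the constants 1 - s tau met below can be
    negative when H is the zero space. *)
Lemma lipschitz_comp_nonexpansive (q : R) (g W : H -> H) :
  q.-lipschitz g -> 1.-lipschitz W -> q.-lipschitz (g \o W).
Proof.
move=> /lipschitzP gq /lipschitzP W1; apply/lipschitzP => u v.
apply: (le_trans (gq _ _)); have := W1 u v; rewrite mul1r.
have [q0|q0] := leP 0 q; first by move=> /(ler_wpM2l q0).
(* a negative constant forces all distances to vanish *)
move=> _; apply: (@le_trans _ _ 0); first by rewrite nmulr_rle0.
exact: le_trans (gq u v).
Qed.

(** Expanding the square gives the factor 1 - 2 s mu eta + (s mu k)^2, which is
    at most (1 - s tau)^2 because s^2 <= s. As soon as the space contains a
    nonzero vector, Cauchy-Schwarz gives eta <= k, whence s tau <= 1. *)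
Lemma descent_lipschitz (A : H -> H) (k eta mu s : R) :
  0 < k -> 0 < eta -> 0 < mu -> 0 <= s <= 1 ->
  k.-lipschitz A -> strongly_monotone dot eta A ->
  (1 - s * (mu * (eta - mu * k ^+ 2 / 2))).-lipschitz
    (fun u => u - (s * mu) *: A u).
Proof.
move=> k0 eta0 mu0 /andP[s0 s1] /lipschitzP Ak Aeta; apply/lipschitzP => u v.
have -> : u - (s * mu) *: A u - (v - (s * mu) *: A v) =
    u - v - (s * mu) *: (A u - A v).
  by rewrite scalerBr !opprD !opprK addrACA.
have := Aeta u v; have := Ak u v.
set w := u - v; set d := A u - A v; set q := 1 - _ => dw wd.
have [w0|w0] := eqVneq `|w| 0.
  have d0 : d = 0.
    by apply/eqP; rewrite -normr_le0 (le_trans dw)// w0 mulr0.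
  by rewrite d0 scaler0 subr0 w0 mulr0.
have {}w0 : 0 < `|w| by rewrite lt0r w0 normr_ge0.
have etak : eta <= k.
  rewrite -(ler_pM2r (exprn_gt0 2 w0)) (le_trans wd)//.
  rewrite (le_trans (dot_le_norm _ _))// expr2 mulrCA ler_wpM2l//.
have q0 : 0 <= q.
  have mk : (mu * eta) ^+ 2 <= (mu * k) ^+ 2.
    by rewrite ler_sqr ?nnegrE ?mulr_ge0 ?(ltW mu0) ?(ltW eta0) ?(ltW k0)//
      ler_wpM2l// ltW.
  have := ler_wpM2l s0 mk; have := sqr_ge0 (mu * eta - 1).
  move=> h; have := ler_wpM2l s0 h.
  by rewrite /q; lra.
rewrite -(@ler_sqr R) ?nnegrE ?mulr_ge0//.
rewrite exprMn normsqD normrN normrZ exprMn real_normK ?num_real//.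
rewrite dotNr dotZr.
have dw2 : `|d| ^+ 2 <= k ^+ 2 * `|w| ^+ 2.
  by rewrite -exprMn ler_sqr ?nnegrE// mulr_ge0// ltW.
have sm2 : 0 <= (s * mu) ^+ 2 by exact: sqr_ge0.
have sm0 : 0 <= 2 * (s * mu) by rewrite !mulr_ge0// ltW.
have h1 := ler_wpM2l sm2 dw2.
have h2 := ler_wpM2l sm0 wd.
have h3 : 0 <= (s * (1 - s)) * (mu * k * `|w|) ^+ 2.
  by apply: mulr_ge0; [rewrite mulr_ge0// subr_ge0|exact: sqr_ge0].
have h4 : 0 <= (s * (mu * (eta - mu * k ^+ 2 / 2)) * `|w|) ^+ 2.
  exact: sqr_ge0.
by rewrite /q; lra.
Qed.

Lemma iter_comp_nonexpansive (S : nat -> H -> H) (r m : nat) :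
  (forall n, 1.-lipschitz (S n)) -> 1.-lipschitz (iter_comp S r m).
Proof.
move=> S1; elim: m => [|m ih] /=; first by apply/lipschitzP => u v; rewrite mul1r.
exact: lipschitz_comp_nonexpansive.
Qed.

(** * The iteration *)

Section hybrid_iteration.
Variables (f A : H -> H) (alpha k eta mu gamma : R).
Hypothesis (alpha_gt0 : 0 < alpha) (f_lip : alpha.-lipschitz f).
Hypotheses (k_gt0 : 0 < k) (eta_gt0 : 0 < eta) (mu_gt0 : 0 < mu).
Hypotheses (gamma_gt0 : 0 < gamma).
Hypotheses (A_lip : k.-lipschitz A) (A_mon : strongly_monotone dot eta A).

Let c := mu * (eta - mu * k ^+ 2 / 2) - gamma * alpha.
Hypothesis c_gt0 : 0 < c.

(** The vector gamma f - mu A evaluated along one step: at a fixed point of [W]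
    it is the field of the variational inequality, which is [drift id]. *)
Definition drift (W : H -> H) z := gamma *: f z - mu *: A (W z).

Definition hybrid_step s (W : H -> H) z := W z + s *: drift W z.

Lemma hybrid_step_lipschitz s W :
  0 <= s <= 1 -> 1.-lipschitz W -> (1 - s * c).-lipschitz (hybrid_step s W).
Proof.
move=> s01 W1; apply/lipschitzP => u v; rewrite /hybrid_step /drift.
have := lipschitz_comp_nonexpansive
  (descent_lipschitz k_gt0 eta_gt0 mu_gt0 s01 A_lip A_mon) W1.
move=> /lipschitzP/(_ u v)/=.
have /andP[s0 s1] := s01.
have sg0 : 0 <= s * gamma by rewrite mulr_ge0// ltW.
have := ler_wpM2l sg0 ((lipschitzP _ _).1 f_lip u v).
set Du := W u - _; set Dv := W v - _ => fuv Duv.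
have -> : W u + s *: (gamma *: f u - mu *: A (W u)) -
    (W v + s *: (gamma *: f v - mu *: A (W v))) =
    (s * gamma) *: (f u - f v) + (Du - Dv).
  have E z : W z + s *: (gamma *: f z - mu *: A (W z)) =
      (s * gamma) *: f z + (W z - (s * mu) *: A (W z)).
    by rewrite scalerBr !scalerA addrCA.
  by rewrite !E opprD addrACA -scalerBr.
apply: (le_trans (ler_normD _ _)); rewrite normrZ ger0_norm//.
apply: (le_trans (lerD fuv Duv)).
by rewrite /c; lra.
Qed.

Variables (N : nat) (T : nat -> H -> H).
Hypothesis N_gt0 : (0 < N)%N.
Hypothesis T_lip : forall i, (1 <= i <= N)%N -> 1.-lipschitz (T i).
Let F := common_fixpts N T.
Let S := periodic_ext N T.
Hypothesis F_cyc : forall r, (r < N)%N -> fixpts (iter_comp S r N) = F.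

Lemma periodic_lipschitz n : 1.-lipschitz (S n).
Proof. by apply: T_lip => /=; rewrite ltn_pmod. Qed.

Lemma periodic_fix p n : F p -> S n p = p.
Proof. by move=> Fp; apply: Fp => /=; rewrite ltn_pmod. Qed.

Lemma periodicD n : (0 < n)%N -> S (n + N) = S n.
Proof. by case: n => // n _; rewrite /S /periodic_ext addSn /= modnDr. Qed.

Lemma iter_comp_modn r m : iter_comp S r m = iter_comp S (r %% N) m.
Proof.
elim: m => //= m ->; congr (_ \o _).
by rewrite /S /periodic_ext !addnS/= modnDml.
Qed.

Variables (a : nat -> R) (x : nat -> H).
Hypothesis a01 : forall n, (1 <= n)%N -> 0 < a n < 1.
Hypothesis a_cvg0 : a n @[n --> \oo] --> (0 : R).
Hypothesis a_sum : \sum_(1 <= n < m) a n @[m --> \oo] --> +oo.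
Hypothesis a_ratio : a n / a (n + N)%N @[n --> \oo] --> (1 : R).
Hypothesis x_rec : forall n, (1 <= n)%N -> x n.+1 = hybrid_step (a n) (S n) (x n).

Lemma near_a01 : \forall n \near \oo, 0 < a n < 1.
Proof. by exists 1%N. Qed.

Lemma near_ac01 : \forall n \near \oo, 0 <= a n * c <= 1.
Proof.
have c1 : 0 < c^-1 by rewrite invr_gt0.
near=> n; have /andP[an0 _] : 0 < a n < 1 by near: n; exact: near_a01.
have : `|a n| <= c^-1 by near: n; exact: cvgr0_norm_le a_cvg0 _ c1.
rewrite ger0_norm ?(ltW an0)// => anc; rewrite mulr_ge0 ?(ltW an0) ?(ltW c_gt0)//.
by rewrite -ler_pdivlMr// div1r.
Unshelve. all: by end_near. Qed.

Lemma ac_sum : \sum_(1 <= n < m) a n * c @[m --> \oo] --> +oo.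
Proof.
apply/cvgryPge => M; move/cvgryPge : a_sum => /(_ (M / c)).
by apply: filterS => m; rewrite ler_pdivrMr// mulr_suml.
Qed.

(** Since S_n p = p, the step moves p exactly by a_n B p. *)
Lemma near_recursion p : F p -> \forall n \near \oo,
  `|x n.+1 - p - a n *: drift id p| <= (1 - a n * c) * `|x n - p|.
Proof.
move=> Fp; apply: filterS2 near_a01 (nbhs_infty_gt 0%N) => n /andP[a0 a1] n0.
have -> : x n.+1 - p - a n *: drift id p =
    hybrid_step (a n) (S n) (x n) - hybrid_step (a n) (S n) p.
  by rewrite x_rec// {3}/hybrid_step /drift periodic_fix// opprD addrA.
apply: ((lipschitzP _ _).1 (hybrid_step_lipschitz _ (periodic_lipschitz n))).
by rewrite !ltW.
Qed.

Hypothesis F0 : F !=set0.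

Lemma iterates_bounded : exists K, \forall n \near \oo, `|x n| <= K.
Proof.
have [p Fp] := F0.
have [K KP] : exists K, \forall n \near \oo, `|x n - p| <= K.
  apply: (@rec_le_bounded R _ (fun n => a n * c) near_ac01 (`|drift id p| / c)).
  apply: filterS2 near_a01 (near_recursion Fp) => n /andP[a0 _] h.
  have := ler_normD (x n.+1 - p - a n *: drift id p) (a n *: drift id p).
  rewrite subrK normrZ gtr0_norm// -mulrA (mulrCA c) mulfV ?mulr1 ?gt_eqF//.
  by lra.
exists (K + `|p|); apply: filterS KP => n; rewrite -lerBlDr; apply: le_trans.
by rewrite lerBlDr -{1}(subrK p (x n)) ler_normD.
Qed.

Lemma drift_bounded : exists K, \forall n \near \oo, `|drift (S n) (x n)| <= K.
Proof.
have [K xK] := iterates_bounded; have [p Fp] := F0.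
exists (gamma * (alpha * (K + `|p|)) + mu * (k * (K + `|p|)) + `|drift id p|).
apply: filterS xK => n xnK.
have xp : `|x n - p| <= K + `|p| by rewrite (le_trans (ler_normB _ _))// lerD2r.
rewrite -[drift _ _](subrK (drift id p)) (le_trans (ler_normD _ _))// lerD2r.
have -> : drift (S n) (x n) - drift id p =
    gamma *: (f (x n) - f p) - mu *: (A (S n (x n)) - A p).
  by rewrite /drift !scalerBr !opprD !opprK addrACA.
rewrite (le_trans (ler_normB _ _))// !normrZ !gtr0_norm//.
apply: lerD; rewrite ler_pM2l//.
  by rewrite (le_trans ((lipschitzP _ _).1 f_lip _ _))// ler_pM2l.
rewrite (le_trans ((lipschitzP _ _).1 A_lip _ _))// ler_pM2l//.
rewrite -{1}(periodic_fix n Fp).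
by rewrite (le_trans ((lipschitzP _ _).1 (periodic_lipschitz n) _ _))// mul1r.
Qed.

Lemma step_sub_cvg0 : `|x n.+1 - S n (x n)| @[n --> \oo] --> (0 : R).
Proof.
have [K dK] := drift_bounded.
have aK : a n * K @[n --> \oo] --> (0 : R).
  by rewrite -(mul0r K); apply: cvgM; [exact: a_cvg0|exact: cvg_cst].
apply: (squeeze_cvgr _ (cvg_cst (0 : R)) aK); near=> n.
have /andP[an0 _] : 0 < a n < 1 by near: n; exact: near_a01.
rewrite normr_ge0 x_rec; last by near: n; exact: nbhs_infty_gt.
rewrite /hybrid_step addrC addKr normrZ gtr0_norm// ler_pM2l//.
by near: n.
Unshelve. all: by end_near. Qed.

Lemma near_subn (P : set nat) (m : nat) :
  (\forall n \near \oo, P n) -> \forall n \near \oo, P (n - m)%N.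
Proof.
move=> [n0 _ n0P]; exists (n0 + m)%N => // n /= n0n; apply: n0P => /=.
by rewrite leq_subRL 1?addnC// (leq_trans _ n0n)// leq_addl.
Qed.

(** S_n = S_(n-N), so that the two steps apply the same map up to the
    difference of their parameters. *)
Lemma near_step_shift :
  exists K, 0 < K /\ \forall n \near \oo,
  `|x n.+1 - x (n.+1 - N)%N| <=
  (1 - a n * c) * `|x n - x (n - N)%N| + `|a n - a (n - N)%N| * K.
Proof.
have [K dK] := drift_bounded.
exists (`|K| + 1); split; first by rewrite ltr_wpDl.
near=> n.
have Nn : (N < n)%N by near: n; exact: nbhs_infty_gt.
have dn : `|drift (S (n - N)%N) (x (n - N)%N)| <= K.
  by near: n; apply: (@near_subn (fun n => `|drift (S n) (x n)| <= K)).
have /andP[a0 a1] : 0 < a n < 1 by near: n; exact: near_a01.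
rewrite subSn ?(ltnW Nn)//; set m := (n - N)%N in dn *.
have m0 : (0 < m)%N by rewrite subn_gt0.
have nm : n = (m + N)%N by rewrite subnK// ltnW.
have SE : S n = S m by rewrite nm periodicD.
have -> : x n.+1 - x m.+1 =
    (hybrid_step (a n) (S n) (x n) - hybrid_step (a n) (S n) (x m)) +
    (a n - a m) *: drift (S m) (x m).
  rewrite !x_rec//; last exact: ltn_trans Nn.
  by rewrite SE /hybrid_step scalerBl !opprD -!addrA addKr.
apply: (le_trans (ler_normD _ _)); apply: lerD.
  apply: ((lipschitzP _ _).1 (hybrid_step_lipschitz _ (periodic_lipschitz n))).
  by rewrite !ltW.
rewrite normrZ ler_wpM2l// (le_trans dn)// (le_trans (ler_norm K))// lerDl//.
Unshelve. all: by end_near. Qed.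

Lemma periodic_shift_cvg0 : `|x (n + N)%N - x n| @[n --> \oo] --> (0 : R).
Proof.
(* backward differences, so that the coefficient is a n and not a (n + N) *)
suff h : `|x n - x (n - N)%N| @[n --> \oo] --> (0 : R).
  move: h; rewrite -(cvg_shiftn N).
  by under eq_fun do rewrite addnK.
apply: (rec_le_cvg0 near_ac01) => //; first exact: ac_sum.
move=> e e0; have [K [K0 KP]] := near_step_shift.
have ecK : 0 < e * c / K by rewrite divr_gt0// mulr_gt0.
have ratio : \forall n \near \oo, `|1 - a (n - N)%N / a n| <= e * c / K.
  have /cvgrPdist_le/(_ _ ecK) h := a_ratio.
  near=> n.
  have Nn : (N <= n)%N by near: n; exact: nbhs_infty_ge.
  have : `|1 - a (n - N)%N / a (n - N + N)%N| <= e * c / K.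
    near: n.
    exact: (@near_subn (fun m => `|1 - a m / a (m + N)%N| <= e * c / K) N h).
  by rewrite subnK.
near=> n.
have /andP[a0 a1] : 0 < a n < 1 by near: n; exact: near_a01.
have : `|1 - a (n - N)%N / a n| <= e * c / K by near: n.
rewrite ler_pdivlMr// -(ler_pM2l a0) => h.
have : `|x n.+1 - x (n.+1 - N)%N| <=
    (1 - a n * c) * `|x n - x (n - N)%N| + `|a n - a (n - N)%N| * K.
  by near: n.
move/le_trans; apply; rewrite lerD2l -mulrA (mulrC c e) (le_trans _ h)// mulrA.
rewrite ler_pM2r// -{2}(gtr0_norm a0) -normrM mulrBr mulr1 mulrCA mulfV ?mulr1//.
by rewrite gt_eqF.
Unshelve. all: by end_near. Qed.

(** Following the maps themselves instead of the iteration costs one vanishing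
    error per step, and the later maps do not enlarge it. *)
Lemma iter_comp_close m :
  `|x (n + m).+1 - iter_comp S n m (x n.+1)| @[n --> \oo] --> (0 : R).
Proof.
elim: m => [|m ih] /=.
  by under eq_fun do rewrite addn0 subrr normr0; exact: cvg_cst.
have h : `|x (n + m.+1).+1 - S (n + m.+1)%N (x (n + m.+1)%N)|
    @[n --> \oo] --> (0 : R).
  by rewrite (cvg_shiftn m.+1 (fun n => `|x n.+1 - S n (x n)|)); exact: step_sub_cvg0.
have := cvgD h ih => /(_ eventually_filter); rewrite addr0 => hih.
apply: (squeeze_cvgr _ (cvg_cst (0 : R)) hih); near=> n.
rewrite normr_ge0/= fctE.
apply: (le_trans (ler_distD (S (n + m.+1)%N (x (n + m.+1)%N)) _ _)).
rewrite lerD2l (le_trans ((lipschitzP _ _).1 (periodic_lipschitz _) _ _))//.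
by rewrite mul1r addnS.
Unshelve. all: by end_near. Qed.

Lemma asymptotic_regularity :
  `|x n.+1 - iter_comp S n N (x n.+1)| @[n --> \oo] --> (0 : R).
Proof.
have h : `|x (n.+1 + N)%N - x n.+1| @[n --> \oo] --> (0 : R).
  by rewrite (cvg_shiftS (fun n => `|x (n + N)%N - x n|)); exact: periodic_shift_cvg0.
have := cvgD h (iter_comp_close N) => /(_ eventually_filter); rewrite addr0 => hih.
apply: (squeeze_cvgr _ (cvg_cst (0 : R)) hih); near=> n.
rewrite normr_ge0/= fctE addSn.
by rewrite (le_trans (ler_distD (x (n + N).+1) _ _))// lerD2r distrC.
Unshelve. all: by end_near. Qed.

Variable x' : H.
Hypothesis x'_VI : VI_solution dot F (drift id) x'.

(** The composition of the next N maps varies with n, but only through n modulo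
    N: demiclosedness is applied separately along each residue class. *)
Lemma limsup_drift_le0 e : 0 < e ->
  \forall n \near \oo, dot (drift id x') (x n.+1 - x') <= e.
Proof.
move=> e0; have [K xK] := iterates_bounded; have [Fx' x'le] := x'_VI.
have : \forall n \near \oo, forall r : 'I_N, (n %% N = r)%N ->
    dot (drift id x') (x n.+1 - x') <= e.
  apply: filter_forall => r.
  pose G := within [set n : nat | (n %% N = r)%N] \oo.
  have GG : Filter G by exact: within_filter.
  apply: (@limsup_dot_le0 nat G (iter_comp S r N) (fun n => x n.+1) K) e0 => //.
  - exact/iter_comp_nonexpansive/periodic_lipschitz.
  - apply: cvg_within; have [n0 _ n0P] := xK.
    by exists n0 => // n /= n0n; apply: n0P; exact: leqW.
  - apply/cvgrPdist_le => d d0; rewrite /G near_withinE.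
    have /cvgrPdist_le/(_ _ d0) := asymptotic_regularity.
    by apply: filterS => n + nr; rewrite iter_comp_modn nr.
  - by move=> y Wy; apply: x'le; rewrite -(F_cyc (ltn_ord r)).
apply: filterS => n /(_ (Ordinal (ltn_pmod n N_gt0))); exact.
Qed.

Lemma hybrid_iteration_cvg : x n @[n --> \oo] --> x'.
Proof.
have [Fx' _] := x'_VI.
have sq : `|x n - x'| ^+ 2 @[n --> \oo] --> (0 : R).
  apply: (rec_le_cvg0 near_ac01); [by move=> n; exact: sqr_ge0|exact: ac_sum|].
  move=> e e0.
  have ce0 : 0 < c * e / 2 by rewrite divr_gt0// mulr_gt0.
  near=> n.
  have /andP[a0 _] : 0 < a n < 1 by near: n; exact: near_a01.
  have /andP[l0 l1] : 0 <= a n * c <= 1 by near: n; exact: near_ac01.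
  have bn : dot (drift id x') (x n.+1 - x') <= c * e / 2.
    by near: n; exact: limsup_drift_le0.
  have : `|x n.+1 - x' - a n *: drift id x'| <= (1 - a n * c) * `|x n - x'|.
    by near: n; exact: near_recursion.
  set b := drift id x' in bn *; set u := x n.+1 - x' in bn *.
  set l := a n * c in l0 l1 *; set v := x n - x' => uv.
  have uv2 : `|u - a n *: b| ^+ 2 <= ((1 - l) * `|v|) ^+ 2.
    by rewrite ler_sqr ?nnegrE// mulr_ge0// subr_ge0.
  (* |u|^2 <= |u - a_n b|^2 + 2 <a_n b, u> *)
  have : (1 - l) ^+ 2 * `|v| ^+ 2 <= (1 - l) * `|v| ^+ 2.
    by rewrite ler_wpM2r ?sqr_ge0// expr2 ler_piMr ?subr_ge0// gerBl.
  have := ler_wpM2l (ltW a0) bn.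
  move: uv2; rewrite exprMn normsqD normrN dotNr dotZr (dotC u b) /l.
  by have := sqr_ge0 `|a n *: b|; lra.
apply/cvgrPdist_le => e e0.
have /cvgrPdist_le/(_ _ (exprn_gt0 2 e0)) := sq.
apply: filterS => n; rewrite sub0r normrN ger0_norm ?sqr_ge0//.
by rewrite ler_sqr ?nnegrE ?(ltW e0)// distrC.
Unshelve. all: by end_near. Qed.

End hybrid_iteration.

End hilbert_space.

Theorem theorem3p2 (R : realType) (H : completeNormedModType R)
    (dot : {dot H for (@idfun R)}) (Hdot : norm_induced_by dot)
    (f : H -> H) (alpha : R) (Halpha : 0 < alpha < 1)
    (Hf : alpha.-lipschitz f)
    (A : H -> H) (k eta : R) (Hk : 0 < k) (Heta : 0 < eta)
    (HAlip : k.-lipschitz A) (HAmon : strongly_monotone dot eta A)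
    (N : nat) (HN : (1 <= N)%N) (T : nat -> H -> H)
    (HT : forall i, (1 <= i <= N)%N -> 1.-lipschitz (T i))
    (HF : common_fixpts N T !=set0)
    (mu : R) (Hmu : 0 < mu < 2 * eta / k ^+ 2)
    (tau : R) (Htau : tau = mu * (eta - mu * k ^+ 2 / 2))
    (gamma : R) (Hgamma : 0 < gamma < tau / alpha)
    (a : nat -> R) (Ha : forall n, (1 <= n)%N -> 0 < a n < 1)
    (Ha0 : a n @[n --> \oo] --> (0 : R))
    (Hasum : \sum_(1 <= n < m) a n @[m --> \oo] --> +oo)
    (Haratio : a n / a (n + N)%N @[n --> \oo] --> (1 : R))
    (Hcyc : forall r, (r < N)%N ->
      fixpts (iter_comp (periodic_ext N T) r N) = common_fixpts N T)
    (x : nat -> H)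
    (Hx : forall n, (1 <= n)%N ->
      x n.+1 = (a n * gamma) *: f (x n)
        + (periodic_ext N T n (x n) - (a n * mu) *: A (periodic_ext N T n (x n)))) :
  exists x' : H,
    unique (VI_solution dot (common_fixpts N T) (fun z => gamma *: f z - mu *: A z)) x'
    /\ x n @[n --> \oo] --> x'.
Proof.
have /andP[alpha0 _] := Halpha.
have /andP[mu0 _] := Hmu.
have /andP[gamma0] := Hgamma; rewrite ltr_pdivlMr// => gammatau.
have c0 : 0 < mu * (eta - mu * k ^+ 2 / 2) - gamma * alpha.
  by rewrite -Htau subr_gt0.
have id1 : 1.-lipschitz (@id H) by exact: lipschitz_id.
have s01 : 0 <= (1 : R) <= 1 by rewrite ler01 lexx.
have Phi1 := hybrid_step_lipschitz Hdot Hf Hk Heta mu0 gamma0 HAlip HAmon s01 id1.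
have q1 : 1 - 1 * (mu * (eta - mu * k ^+ 2 / 2) - gamma * alpha) < 1.
  by rewrite mul1r gtrBl.
have [x' x'P] := contraction_VI Hdot HF (common_fixpts_closed HT)
  (common_fixpts_segment Hdot HT) q1 Phi1.
have E : (fun z => hybrid_step f A mu gamma 1 id z - z) =
    (fun z => gamma *: f z - mu *: A z).
  by apply/funext => z; rewrite /hybrid_step scale1r addrC addKr.
rewrite E in x'P; exists x'; split=> //.
apply: (hybrid_iteration_cvg Hdot alpha0 Hf Hk Heta mu0 gamma0 HAlip HAmon c0 HN
  HT Hcyc Ha Ha0 Hasum Haratio _ HF (proj1 x'P)) => n n0.
by rewrite Hx// /hybrid_step /drift scalerBr !scalerA addrCA.
Qed.
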